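(* Let $G=(V;E)$ be the random graph and let $\Gamma$ be a structure with domain $V$ all of whose relations are first-order definable in $G$. Then at least one of the following holds: (1) $\Gamma$ has a constant endomorphism; (2) $e_E$ is an endomorphism of $\Gamma$; (3) $e_N$ is an endomorphism of $\Gamma$; (4) $-$ is an automorphism of $\Gamma$; (5) ${\it sw}$ is an automorphism of $\Gamma$; (6) every endomorphism of $\Gamma$ lies in the smallest locally closed monoid of maps $V\to V$ containing $\mathrm{Aut}(G)$.
   Context: The random graph $G=(V;E)$ is the unique countably infinite graph such that for all finite disjoint $U,U'\subseteq V$ there is $v\in V\setminus(U\cup U')$ adjacent to all of $U$ and none of $U'$. A monoid of maps $V\to V$ is locally closed if it is closed in the product topology on $V^V$ ($V$ discrete). $e_E$ is a fixed injective map $V\to V$ whose image induces an infinite clique in $G$; $e_N$ is a fixed injective map $V\to V$ whose image induces an infinite independent set in $G$. $-$ is a fixed isomorphism from $G$ onto its complement graph. For a fixed vertex $0\in V$, ${\it sw}$ is a fixed isomorphism from $G$ onto the graph obtained from $G$ by exchanging edges and non-edges between $\{0\}$ and $V\setminus\{0\}$ (this graph is isomorphic to $G$). Different choices of these maps generate the same locally closed monoids together with $\mathrm{Aut}(G)$. An endomorphism of $\Gamma$ is a map $V\to V$ preserving all relations of $\Gamma$. *)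

(* Defs.v *)
From mathcomp Require Import all_boot finmap.
From mathcomp Require Import all_classical topology.

Set Implicit Arguments.
Unset Strict Implicit.
Unset Printing Implicit Defensive.

Local Open Scope classical_set_scope.

Section Graphs.
Variable V : countType.
Implicit Types (E : rel V) (A : set V).

Definition random_graph E : Prop :=
  [/\ symmetric E, irreflexive E, infinite_set [set: V] &
      forall U U' : {fset V}, [disjoint U & U']%fset ->
        exists v : V, [/\ v \notin (U `|` U')%fset,
          forall u, u \in U -> E v u & forall u, u \in U' -> ~~ E v u]].

Definition graph_iso E E' (f : V -> V) : Prop :=
  bijective f /\ forall x y, E x y = E' (f x) (f y).

Definition graph_aut E : set (V -> V) := [set f | graph_iso E E f].

Definition graph_compl E : rel V := [rel x y | (x != y) && ~~ E x y].

Definition graph_switch E (z : V) : rel V :=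
  [rel x y | if (x == z) (+) (y == z) then ~~ E x y else E x y].

Definition clique E A : Prop := forall x y, A x -> A y -> x <> y -> E x y.

Definition independent E A : Prop := forall x y, A x -> A y -> ~~ E x y.

End Graphs.

(* [formula n]: first-order formulas in the language of graphs (with equality,
   without parameters) whose free variables are among n variables. [FForall]
   binds variable 0 of its body; variable i outside is variable i+1 inside. *)
Inductive formula : nat -> Type :=
| FFalse n : formula n
| FEq n (i j : 'I_n) : formula n
| FEdge n (i j : 'I_n) : formula n
| FImp n (phi psi : formula n) : formula n
| FForall n (phi : formula n.+1) : formula n.

Fixpoint sat (V : Type) (E : rel V) n (phi : formula n) :
    n.-tuple V -> Prop :=
  match phi in formula n return n.-tuple V -> Prop with
  | FFalse _ => fun _ => False
  | FEq _ i j => fun t => tnth t i = tnth t j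
  | FEdge _ i j => fun t => E (tnth t i) (tnth t j)
  | FImp _ phi psi => fun t => sat E phi t -> sat E psi t
  | FForall _ phi => fun t => forall v : V, sat E phi [tuple of v :: t]
  end.

Definition fo_definable (V : Type) (E : rel V) n (R : set (n.-tuple V)) : Prop :=
  exists phi : formula n, forall t, R t <-> sat E phi t.

Record structure (V : Type) := Structure {
  symbol : Type;
  arity : symbol -> nat;
  interp : forall s : symbol, set ((arity s).-tuple V)
}.

Section Structures.
Variables (V : Type) (Gamma : structure V).

Definition endomorphism (f : V -> V) : Prop :=
  forall (s : symbol Gamma) (t : (arity s).-tuple V),
    interp t -> interp (map_tuple f t).

Definition automorphism (f : V -> V) : Prop :=
  bijective f /\
  forall (s : symbol Gamma) (t : (arity s).-tuple V),
    interp t <-> interp (map_tuple f t).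

End Structures.

Definition locally_closed_monoid (V : choiceType) (M : set (V -> V)) : Prop :=
  [/\ M id,
      forall f g, M f -> M g -> M (f \o g) &
      closed (M : set {ptws V -> discrete_topology V})].

(* Main.v *)
(* Let M be the monoid of endomorphisms of Gamma. It contains Aut(G) and is
   closed under pointwise limits, so by homogeneity of G membership in M only
   depends on the patterns (equalities and edges) realized on finite sets.

   If M contains a non-injective map, pairs of one kind (edges or non-edges) can
   be collapsed until the image is a clique or an independent set; in the limit
   one gets g in M with such an image, and either some fibre of g contains a copy
   of every finite graph, which yields a constant, or every finite graph has a
   copy on which g is injective, which yields e_E or e_N.

   If all maps in M are injective but some f in M changes the edge relation
   between c and d, then f can be replaced by a map g in M agreeing with f on the
   edge relation of c and d and such that E (g x) (g y) depends only on the type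
   of (x, y) over {c, d}. This is a Ramsey statement, obtained from the
   indivisibility of G, a pigeonhole argument on boxes (for pairs of vertices of
   different types) and the finite Ramsey theorem (for pairs of the same type).
   Such a g behaves, on each kind of pairs other than {c, d}, as the identity, or
   else it generates e_E, e_N, - or sw. If it is the identity on all of them,
   then M can change one edge (or one non-edge) at a time, and e_N or e_E is in M. *)
Require Import Defs.
From mathcomp Require Import all_boot finmap.
From mathcomp Require Import all_classical topology.

Set Implicit Arguments.
Unset Strict Implicit.
Unset Printing Implicit Defensive.

Local Open Scope nat_scope.

(** * Finite Ramsey and box-pigeonhole statements *)

Section Ramsey.

Lemma pigeonhole_count (T : Type) (K : finType) (c : T -> K) m (s : seq T) :
  #|K| * m < size s -> exists k, m < count (fun x => c x == k) s.
Proof.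
move=> lt; apply: contrapT => /forallNP nk; move: lt; apply/negP; rewrite -leqNgt.
rewrite -sum1_size (partition_big c predT) //= -sum_nat_const.
apply: leq_sum => k _; rewrite sum1_count leqNgt; exact/negP/nk.
Qed.

(** Greedy half of Ramsey's theorem: keep the first point, pass to a large colour class of the
    remaining ones, and recurse. *)
Lemma end_homogeneous (K : finType) m : exists N, forall (col : nat -> nat -> K) (s : seq nat),
  uniq s -> N <= size s -> exists ks cc,
    [/\ size ks = m, {subset ks <= s}, uniq ks & pairwise (fun x y => col x y == cc x) ks].
Proof.
elim: m => [|m [N IH]].
  by exists 0 => col s _ _; exists [::], (col 0).
exists (#|K| * N).+2 => col [//|x s] /= /andP[xs us]; rewrite ltnS => /(pigeonhole_count (col x)).
move=> [k]; rewrite -size_filter => /ltnW Nk.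
have [ks [cc [sz sub u pw]]] := IH col _ (filter_uniq _ us) Nk.
have kss y : y \in ks -> col x y = k /\ y \in s by move=> /sub; rewrite mem_filter => /andP[/eqP].
have xks : x \notin ks by apply: contra xs => /kss[].
exists (x :: ks), (fun y => if y == x then k else cc y); split=> /=.
- by rewrite sz.
- by move=> y; rewrite !inE => /predU1P[->|/kss[_ ->]]; rewrite ?eqxx ?orbT.
- by rewrite xks.
apply/andP; split; first by apply/allP => y /kss[-> _]; rewrite !eqxx.
apply: (@sub_in_pairwise _ (mem ks)) pw; last exact/allP.
by move=> y z yks _ /=; case: (eqVneq y x) => // yx; rewrite -yx yks in xks.
Qed.

Lemma ramsey (K : finType) n : exists N, forall col : nat -> nat -> K,
  exists (ks : seq nat) (k : K), [/\ size ks = n, {in ks, forall x, x < N}, uniq ks &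
    pairwise (fun x y => col x y == k) ks].
Proof.
have [N NP] := end_homogeneous K (#|K| * n).+1; exists N => col.
have [|ks [cc [sz sub u pw]]] := NP col (iota 0 N) (iota_uniq _ _); first by rewrite size_iota.
(* A second pigeonhole, on the colours [cc] of the end-homogeneous list. *)
have [|k] := @pigeonhole_count _ _ cc n ks; first by rewrite sz.
rewrite -size_filter => /ltnW; set q := [seq x <- ks | _] => nq.
exists (take n q), k; split.
- by rewrite size_takel.
- by move=> x /mem_take; rewrite mem_filter => /andP[_ /sub]; rewrite mem_iota.
- by apply: take_uniq; exact: filter_uniq.
have : pairwise (fun x y => col x y == cc x) (take n q).
  apply: subseq_pairwise pw; apply: subseq_trans (take_subseq _ _) (filter_subseq _ _).
apply: (@sub_in_pairwise _ (mem (take n q))); last exact/allP.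
by move=> x y /mem_take; rewrite mem_filter => /andP[/eqP <-].
Qed.

(** Induction on the coordinates: for a new coordinate [l], colour the rest by the vector of colours
    obtained as [l] runs through [#|K|.+1] values. On a box where this vector is constant, two of
    its entries agree, and these give the two sides at [l]. Vanishing off [L] makes [y] determined
    by its values on [L]. *)
Lemma box (J : eqType) (L : seq J) (K : finType) : exists N, forall col : (J -> nat) -> K,
  exists a b : J -> nat, {in L, forall l, [/\ a l < N, b l < N & a l != b l]} /\
    exists k, forall y, {in L, forall l, y l = a l \/ y l = b l} ->
      (forall j, j \notin L -> y j = 0) -> col y = k.
Proof.
elim: L K => [|l L IH] K.
  exists 0 => col; exists (fun=> 0), (fun=> 0); split=> //.
  exists (col (fun=> 0)) => y _ y0; congr col; apply/funext => j; exact: y0.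
have [lL|lL] := boolP (l \in L).
  have [N NP] := IH K; exists N => col; have [a [b [ab [k kP]]]] := NP col.
  have sub : l :: L =i L by move=> j; rewrite inE; case: eqVneq => // ->.
  exists a, b; split=> [j|]; first by rewrite sub; exact: ab.
  by exists k => y yL y0; apply: kP => j jL; [apply: yL; rewrite sub|apply: y0; rewrite sub].
have [N NP] := IH {ffun 'I_#|K|.+1 -> K}; exists (N + #|K|.+1) => col.
pose upd (y : J -> nat) n j := if j == l then n else y j.
have [a [b [ab [k kP]]]] := NP (fun y => [ffun n : 'I_#|K|.+1 => col (upd y n)]).
have [n [m [nm knm]]] : exists n m, n != m /\ k n = k m.
  apply: contrapT => nex; have := leq_card k; rewrite card_ord ltnn => H.
  suff /H : injective k by [].
  by move=> n m nm; apply/eqP/negP => /negP nm'; apply: nex; exists n, m.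
exists (upd a n), (upd b m); split=> [j|].
  rewrite inE /upd; case: eqVneq => [_ _|_ /= /ab[aj bj abj]]; split=> //.
  - exact: leq_trans (ltn_ord n) (leq_addl _ _).
  - exact: leq_trans (ltn_ord m) (leq_addl _ _).
  - exact: leq_trans aj (leq_addr _ _).
  - exact: leq_trans bj (leq_addr _ _).
exists (k n) => y yL y0; have yE : y = upd (upd y 0) (y l).
  by apply/funext => j; rewrite /upd; case: eqVneq => // ->.
have [p [yp kp]] : exists p : 'I_#|K|.+1, y l = p /\ k p = k n.
  have := yL l; rewrite inE eqxx /upd eqxx => /(_ isT)[]->; [exists n|exists m] => //.
rewrite yE yp -kp; have <- := kP (upd y 0); first by rewrite ffunE.
  move=> j jL; rewrite /upd ifN; last by apply: contraNneq lL => <-.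
  have := yL j; rewrite inE jL orbT /upd; have -> : (j == l) = false.
    by apply: contraNF lL => /eqP <-.
  by apply.
move=> j jL; rewrite /upd; case: eqVneq => // jl; apply: y0.
by rewrite inE negb_or jl.
Qed.

End Ramsey.

(** * The random graph: realizing types, homogeneity, universality *)

Section RandomGraph.
Variables (V : countType) (E : rel V).
Hypothesis hG : random_graph E.

Lemma E_sym : symmetric E. Proof. by case: hG. Qed.
Lemma E_irr : irreflexive E. Proof. by case: hG. Qed.

Lemma extension (S : seq V) (t : V -> bool) :
  exists2 v, v \notin S & forall x, x \in S -> E v x = t x.
Proof.
case: hG => _ _ _ ext.
have [|v [vS v1 v0]] := ext [fset x in S | t x]%fset [fset x in S | ~~ t x]%fset.
  apply/fdisjointP => x; rewrite !inE /= => /andP[_ ->].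
  by rewrite andbF.
exists v.
  by apply: contra vS => vS; rewrite !inE /= vS; case: (t v).
move=> x xS; case tx: (t x).
  by apply: v1; rewrite !inE /= xS.
by apply/negbTE/v0; rewrite !inE /= xS tx.
Qed.

(** Vertices are chosen one at a time along [s], each with a prescribed type over [S] and over the
    earlier choices. [D] is the separation demanded from [S] and between the choices (distinctness,
    or distinctness of images), and [chi] is the graph to be copied. *)
Lemma realize_sep (D : rel V) (J : eqType) (s : seq J) (chi : rel J) (S : seq V)
    (T : J -> V -> bool) (good : J -> V -> Prop) :
  symmetric D -> irreflexive D -> symmetric chi ->
  (forall j (S' : seq V) t, j \in s -> {subset S <= S'} -> {in S, t =1 T j} ->
     exists w, [/\ {in S', forall z, D w z}, {in S', E w =1 t} & good j w]) ->
  exists i : J -> V,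
    (forall j, j \in s ->
      [/\ {in S, forall z, D (i j) z}, {in S, E (i j) =1 T j} & good j (i j)]) /\
    (forall j k, j \in s -> k \in s -> j != k ->
       D (i j) (i k) /\ E (i j) (i k) = chi j k).
Proof.
move=> DC Dxx chiC; elim: s => [|j s IH] H.
  have [v _ _] := extension [::] xpred0.
  by exists (fun=> v).
have [|i [i1 i2]] := IH.
  by move=> k S' t ks; apply: H; rewrite inE ks orbT.
have [js|js] := boolP (j \in s).
  exists i; split=> [k|k l]; rewrite !inE.
    by move=> /predU1P[->|]; exact: i1.
  by move=> /predU1P[->|ks] /predU1P[->|ls]; exact: i2.
(* The type wanted for the new vertex: [T j] on [S], and adjacency [chi j k] to the earlier choice
   [i k]. Since [D] is irreflexive, separation makes [i] injective on [s], so reading [k] off [i k]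
   is unambiguous. *)
pose t z := if z \in S then T j z else has (fun k => (i k == z) && chi j k) s.
have [|||w [wS wt wg]] := H j (S ++ map i s) t; rewrite ?mem_head //.
- by move=> x xS; rewrite mem_cat xS.
- by move=> x xS; rewrite /t xS.
have wk k : k \in s -> D w (i k) /\ E w (i k) = chi j k.
  move=> ks; have ikS : i k \in S ++ map i s by rewrite mem_cat map_f ?orbT.
  split; first exact: wS.
  rewrite wt // /t ifN.
    apply/hasP/idP => [[l ls /andP[/eqP e]]|jk]; last by exists k; rewrite ?eqxx.
    by have [<-//|lk] := eqVneq l k; have [] := i2 _ _ ls ks lk; rewrite e Dxx.
  by apply/negP => ikS'; have [/(_ _ ikS')] := i1 _ ks; rewrite Dxx.
exists (fun k => if k == j then w else i k); split=> [k|k l]; rewrite !inE.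
  case: eqVneq => [->|_] /=; last exact: i1.
  split=> //; first by move=> z zS; apply: wS; rewrite mem_cat zS.
  by move=> x xS; rewrite wt ?mem_cat ?xS // /t xS.
case: (eqVneq k j) => [->|_] /=; case: (eqVneq l j) => [->|_] //=; last exact: i2.
  by move=> _ /wk.
by move=> /wk[kw kE] _ _; rewrite DC (E_sym (i k)) chiC.
Qed.

Lemma realize (J : eqType) (s : seq J) (chi : rel J) (S : seq V)
    (T : J -> V -> bool) (good : J -> V -> Prop) :
  symmetric chi ->
  (forall j (S' : seq V) t, j \in s -> {subset S <= S'} -> {in S, t =1 T j} ->
     exists w, [/\ w \notin S', {in S', E w =1 t} & good j w]) ->
  exists i : J -> V,
    (forall j, j \in s -> [/\ i j \notin S, {in S, E (i j) =1 T j} & good j (i j)]) /\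
    (forall j k, j \in s -> k \in s -> j != k ->
       i j != i k /\ E (i j) (i k) = chi j k).
Proof.
move=> chiC H.
have [|||j S' t js SS' tT|i [i1 i2]] := @realize_sep [rel x y | x != y] _ s chi S T good.
- by move=> x y /=; rewrite eq_sym.
- by move=> x /=; rewrite eqxx.
- exact: chiC.
- have [w [wS wt wg]] := H j S' t js SS' tT; exists w; split=> // z zS /=.
  by apply: contraNneq wS => ->.
exists i; split=> // j /i1[iS iT ig]; split=> //.
by apply/negP => /iS /=; rewrite eqxx.
Qed.

Lemma realize_free (J : eqType) (s : seq J) (chi : rel J) (S : seq V)
    (T : J -> V -> bool) : symmetric chi ->
  exists i : J -> V,
    (forall j, j \in s -> i j \notin S /\ {in S, E (i j) =1 T j}) /\
    (forall j k, j \in s -> k \in s -> j != k ->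
       i j != i k /\ E (i j) (i k) = chi j k).
Proof.
move=> chiC; have [|i [i1 i2]] := realize (s := s) (S := S) (T := T) (good := fun _ _ => True) chiC.
  by move=> j S' t _ _ _; have [w wS wt] := extension S' t; exists w.
by exists i; split=> // j /i1[].
Qed.

Definition pemb (F : seq V) (i : V -> V) :=
  forall x y, x \in F -> y \in F ->
    (i x == i y) = (x == y) /\ E (i x) (i y) = E x y.

Definition piso (p : seq (V * V)) := forall a b, a \in p -> b \in p ->
  (a.1 == b.1) = (a.2 == b.2) /\ E a.1 b.1 = E a.2 b.2.

Let swap (a : V * V) := (a.2, a.1).

Lemma piso_swap p : piso p -> piso (map swap p).
Proof.
by move=> pp _ _ /mapP[a ap ->] /mapP[b bp ->] /=; have [-> ->] := pp a b ap bp.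
Qed.

Lemma piso_forth p x : piso p -> exists y, piso ((x, y) :: p).
Proof.
move=> pp; have [/mapP[a ap ->]|xp] := boolP (x \in map fst p).
  exists a.2 => // b c; rewrite -surjective_pairing !inE.
  by move=> /predU1P[->|bp] /predU1P[->|cp]; apply: pp.
have [y yp yE] := extension (map snd p) (fun z => has (fun a => (a.2 == z) && E x a.1) p).
have yE' a : a \in p -> (x == a.1) = (y == a.2) /\ E x a.1 = E y a.2.
  move=> ap; split.
    apply/idP/idP => /eqP e; first by move: xp; rewrite e map_f.
    by move: yp; rewrite e map_f.
  rewrite yE ?map_f //; apply/idP/hasP => [xa|[b bp /andP[/eqP ba]]].
    by exists a; rewrite ?eqxx.
  by have [/esym] := pp _ _ bp ap; rewrite ba eqxx => /esym/eqP ->.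
exists y => // b c; rewrite !inE => /predU1P[->|bp] /predU1P[->|cp] /=; last exact: pp.
- by rewrite !eqxx !E_irr.
- exact: yE'.
by rewrite eq_sym E_sym [b.2 == _]eq_sym [E b.2 _]E_sym; exact: yE'.
Qed.

(** The forth step is used once for [p] and once for the inverse of the result, so that [x] enters
    both the domain and the range. *)
Lemma piso_step (p : {p | piso p}) x : exists q : {p | piso p},
  [/\ {subset sval p <= sval q}, x \in map fst (sval q) & x \in map snd (sval q)].
Proof.
case: p => p pp; have [y yp] := piso_forth x pp.
have [z zp] := piso_forth x (piso_swap yp).
have e : (map swap ((x, z) :: map swap ((x, y) :: p))) = (z, x) :: (x, y) :: p.
  by rewrite /= -map_comp map_id_in // => -[].
exists (exist _ _ (eq_ind _ piso (piso_swap zp) _ e)) => /=; split=> [a ap||].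
- by rewrite !inE ap !orbT.
- by rewrite !inE eqxx orbT.
- by rewrite !inE eqxx.
Qed.

(** Back-and-forth: stage [n.+1] treats the vertex with code [n], if there is one, and the union of
    the stages is the graph of an automorphism. *)
Lemma homogeneity (F : seq V) (i : V -> V) : pemb F i ->
  exists2 a, graph_aut E a & {in F, a =1 i}.
Proof.
move=> iF; have p0 : piso [seq (x, i x) | x <- F].
  by move=> _ _ /mapP[x xF ->] /mapP[y yF ->] /=; have [-> ->] := iF x y xF yF.
have [st stP] := choice (fun px : {p | piso p} * V => piso_step px.1 px.2).
pose P := fix P n := if n is m.+1 then
  (if choice.unpickle m is Some x then st (P m, x) else P m) else exist _ _ p0.
have PS n : {subset sval (P n) <= sval (P n.+1)}.
  by move=> a /=; case: choice.unpickle => // x aP; have [+ _ _] := stP (P n, x); apply.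
have Pmono m n : m <= n -> {subset sval (P m) <= sval (P n)}.
  elim: n => [|n IH]; first by rewrite leqn0 => /eqP ->.
  by rewrite leq_eqVlt => /predU1P[->//|mn] a /(IH mn) /PS.
have Piso m n a b : a \in sval (P m) -> b \in sval (P n) ->
    (a.1 == b.1) = (a.2 == b.2) /\ E a.1 b.1 = E a.2 b.2.
  move=> /(Pmono _ _ (leq_maxl m n)) + /(Pmono _ _ (leq_maxr m n)).
  exact: (svalP (P (maxn m n))).
have f1 x : exists y, exists n, (x, y) \in sval (P n).
  have [_ + _] := stP (P (choice.pickle x), x) => /mapP[[u v] uv /= xu].
  by exists v, (choice.pickle x).+1; rewrite /= choice.pickleK; move: uv; rewrite -xu.
have f2 x : exists y, exists n, (y, x) \in sval (P n).
  have [_ _] := stP (P (choice.pickle x), x) => /mapP[[u v] uv /= xu].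
  by exists u, (choice.pickle x).+1; rewrite /= choice.pickleK; move: uv; rewrite -xu.
have [a aP] := choice f1; have [b bP] := choice f2.
exists a.
  split; last by move=> x y; have [m xm] := aP x; have [n yn] := aP y;
    have [_] := Piso _ _ _ _ xm yn.
  exists b => x; [have [m] := aP x; have [n] := bP (a x)|
    have [n] := bP x; have [m] := aP (b x)] => h1 h2;
    have [/= e _] := Piso _ _ _ _ h1 h2; apply/eqP.
  + by rewrite e eqxx.
  + by rewrite -e eqxx.
move=> x xF; have [n xn] := aP x.
have [/= + _] := Piso 0 n (x, i x) _ (map_f (fun x => (x, i x)) xF) xn.
by rewrite eqxx => /esym/eqP.
Qed.

(** Greedy embedding in the order of the codes; numbers coding no vertex are treated as isolated
    points. It serves to realize limit patterns inside [G]. *)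
Lemma universal (chi : rel V) : symmetric chi ->
  exists2 h : V -> V, injective h & forall x y, x != y -> E (h x) (h y) = chi x y.
Proof.
move=> chiC.
pose c m n := if choice.unpickle m is Some x then
  if choice.unpickle n is Some y then chi x y else false else false.
have H (s : seq V) : exists v, v \notin s /\
    forall i, i < size s -> uniq s -> forall d, E v (nth d s i) = c (size s) i.
  have [v vs vE] := extension s (fun z => c (size s) (index z s)).
  by exists v; split=> // i si us d; rewrite vE ?mem_nth // index_uniq.
have [nx nxP] := choice H.
pose s n := iter n (fun s => rcons s (nx s)) [::].
have sz n : size (s n) = n by elim: n => //= n IH; rewrite size_rcons IH.
have us n : uniq (s n).
  by elim: n => //= n IH; rewrite rcons_uniq IH andbT; case: (nxP (s n)).
have sE m n d : m < n -> nth d (s n) m = nx (s m).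
  elim: n => // n IH; rewrite ltnS leq_eqVlt => /predU1P[->|mn] /=.
    by rewrite nth_rcons sz ltnn eqxx.
  by rewrite nth_rcons sz mn IH.
have lt m n : m < n -> nx (s m) != nx (s n) /\ E (nx (s n)) (nx (s m)) = c n m.
  move=> mn; have [n1 n2] := nxP (s n); have d := nx (s n); split.
    by apply: contraNneq n1 => <-; rewrite -(sE _ _ d mn) mem_nth ?sz.
  by rewrite -(sE _ _ d mn) n2 ?sz.
have cE x y : c (choice.pickle x) (choice.pickle y) = chi x y by rewrite /c !choice.pickleK.
exists (fun x => nx (s (choice.pickle x))).
  move=> x y; case: (ltngtP (choice.pickle x) (choice.pickle y)) => [|/lt[/eqP + _]|].
  - by move=> /lt[/eqP + _].
  - by move=> + /esym.
  - by move=> /(pcan_inj choice.pickleK).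
move=> x y xy; case: (ltngtP (choice.pickle x) (choice.pickle y)) => [/lt[_]|/lt[_]|].
- by rewrite E_sym => ->; rewrite cE chiC.
- by move=> ->.
- by move=> /(pcan_inj choice.pickleK)/eqP; rewrite (negbTE xy).
Qed.

End RandomGraph.

(** * Locally closed monoids containing the automorphisms of [G] *)

Section LocalMonoid.
Variables (V : countType) (E : rel V).
Hypothesis hG : random_graph E.
Variable M : (V -> V) -> Prop.
Hypothesis M_aut : forall a, graph_aut E a -> M a.
Hypothesis M_comp : forall f g, M f -> M g -> M (f \o g).
Hypothesis M_local : forall g,
  (forall F : seq V, exists2 f, M f & {in F, f =1 g}) -> M g.

Definition same_pattern (F : seq V) (f g : V -> V) :=
  forall x y, x \in F -> y \in F ->
    (f x == f y) = (g x == g y) /\ E (f x) (f y) = E (g x) (g y).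

Lemma M_id : M id.
Proof. by apply: M_aut; split=> //; exists id. Qed.

Lemma M_pemb F i g : M g -> pemb E F i -> exists2 h, M h & {in F, h =1 g \o i}.
Proof.
move=> Mg /(homogeneity hG)[a /M_aut Ma ai].
by exists (g \o a); [exact: M_comp|move=> x xF /=; rewrite ai].
Qed.

(** The map sending [f x] to [g x] is a well-defined partial embedding of [map f F], and homogeneity
    extends it. In the proof, [i] looks up a preimage in [F] and applies [g]. *)
Lemma same_pattern_align F f g : same_pattern F f g ->
  exists2 a, graph_aut E a & {in F, a \o f =1 g}.
Proof.
move=> fg; pose i z := g (nth z F (index z (map f F))).
have iE x : x \in F -> i (f x) = g x.
  move=> xF; have fxF : f x \in map f F by rewrite map_f.
  have lt : index (f x) (map f F) < size F by rewrite -(size_map f) index_mem.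
  set y := nth (f x) F (index (f x) (map f F)).
  have yF : y \in F by rewrite mem_nth.
  have fy : f y = f x by rewrite -(nth_map _ (f x)) // nth_index.
  by apply/eqP; rewrite -[i _]/(g y); have [<- _] := fg y x yF xF; rewrite fy.
have [|a aut ai] := homogeneity hG (F := map f F) (i := i).
  move=> _ _ /mapP[x xF ->] /mapP[y yF ->]; rewrite !iE //.
  by have [-> ->] := fg x y xF yF.
by exists a => // x xF /=; rewrite ai ?map_f // iE.
Qed.

Lemma M_pat g : (forall F, exists2 f, M f & same_pattern F f g) -> M g.
Proof.
move=> H; apply: M_local => F; have [f Mf /same_pattern_align[a aut afg]] := H F.
by exists (a \o f) => //; apply: M_comp => //; exact: M_aut.
Qed.

(** * Compactness through an ultrafilter *)

Section Compactness.
Local Open Scope classical_set_scope.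

Lemma filter_seq (T : Type) (I : eqType) (U : set_system T) (s : seq I) (A : I -> set T) :
  Filter U -> (forall i, i \in s -> U (A i)) ->
  U [set t | forall i, i \in s -> A i t].
Proof.
move=> FU; elim: s => [|i s IH] H; first by apply: filterS filterT.
have /IH Us : forall j, j \in s -> U (A j) by move=> j js; apply: H; rewrite inE js orbT.
apply: filterS (filterI (H i (mem_head _ _)) Us) => t [ti ts] j.
by rewrite inE => /predU1P[->//|]; exact: ts.
Qed.

(** Pick [fs n] in [M] good for the vertices with code below [n]. Equalities and edges holding for
    almost all [n] along a nonprincipal ultrafilter define a limit pattern on [V], which [universal]
    realizes inside [G]. On each finite set the realizing map has the pattern of some late [fs n],
    hence it lies in [M] and inherits [Phi]. *)
Lemma compactness (Phi : seq V -> (V -> V) -> Prop) :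
  (forall F F' f, {subset F' <= F} -> Phi F f -> Phi F' f) ->
  (forall F f g, same_pattern F f g -> Phi F f -> Phi F g) ->
  (forall F, exists2 f, M f & Phi F f) ->
  exists2 g, M g & forall F, Phi F g.
Proof.
move=> mono compat sat.
pose S n : seq V := pmap choice.unpickle (iota 0 n).
have SP (F : seq V) : exists N, forall n, (N <= n)%N -> {subset F <= S n}.
  exists (\max_(x <- F) choice.pickle x).+1 => n Nn x xF.
  rewrite mem_pmap; apply/mapP; exists (choice.pickle x); last by rewrite choice.pickleK.
  rewrite mem_iota /= add0n; apply: leq_trans Nn; rewrite ltnS.
  by rewrite (big_rem x) //= leq_maxl.
have [fs fsP] : exists fs : nat -> V -> V, forall n, M (fs n) /\ Phi (S n) (fs n).
  have H n : exists f, M f /\ Phi (S n) f by have [f Mf Pf] := sat (S n); exists f.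
  by have [fs fsP] := choice H; exists fs.
have [U [UU ooU]] := @ultraFilterLemma nat \oo _.
have UP : ProperFilter U := ultra_proper.
(* Every Boolean sequence takes one of its two values almost everywhere; that value is its limit. *)
have UE (b : nat -> bool) : U [set n | b n = `[< U [set n | b n] >]].
  have [Ub|Ub] := in_ultra_setVsetC [set n | b n] UU.
    by rewrite (asboolT Ub).
  rewrite asboolF => [|Ub']; first by apply: filterS Ub => n /= /negP/negbTE.
  by have [m []] := filter_ex (filterI Ub' Ub).
pose eqv x y := `[< U [set n | fs n x == fs n y] >].
pose chi x y := `[< U [set n | E (fs n x) (fs n y)] >].
pose good x y := [set n | (fs n x == fs n y) = eqv x y /\ E (fs n x) (fs n y) = chi x y].
have Ugood x y : U (good x y) by apply: filterI; exact: UE.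
have ex (s : seq (V * V)) : exists n, forall p, p \in s -> good p.1 p.2 n.
  have [n np] := filter_ex (filter_seq (A := fun p : V * V => good p.1 p.2) (s := s) _
    (fun p _ => Ugood p.1 p.2)).
  by exists n.
have chiC : symmetric chi.
  move=> x y; have [n H] := ex [:: (x, y); (y, x)].
  have [_ /= <-] := H (x, y) (mem_head _ _).
  by have [|_ /= <-] := H (y, x); rewrite ?inE ?eqxx ?orbT // (E_sym hG).
have eqvP x y : reflect (exists n, good x y n /\ fs n x = fs n y) (eqv x y).
  apply: (iffP idP) => [xy|[n [[]]]]; last by move=> + _ => <- ->.
  by have [n gn] := filter_ex (Ugood x y); exists n; split=> //; case: gn; rewrite xy => /eqP.
have eqvv x : eqv x x.
  by have [n gn] := filter_ex (Ugood x x); apply/eqvP; exists n.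
have eqvE x y : eqv x y -> eqv x =1 eqv y.
  move=> xy z; have [n H] := ex [:: (x, y); (x, z); (y, z)].
  have [/= ] := H (x, y) (mem_head _ _); rewrite xy => /eqP e _.
  have [|/= <- _] := H (x, z); first by rewrite !inE eqxx orbT.
  by have [|/= <- _] := H (y, z); rewrite ?inE ?eqxx ?orbT // e.
(* Canonical representatives of the limit equality [eqv]: [choose] gives the same result for
   extensionally equal predicates. *)
pose r x := choose (eqv x) x.
have rP x : eqv x (r x) by exact: chooseP.
have rE x y : (r x == r y) = eqv x y.
  apply/eqP/idP => [e|xy]; last by rewrite /r (eq_choose (eqvE _ _ xy));
    apply: choose_id; rewrite -?(eqvE _ _ xy).
  by rewrite (eqvE _ _ (rP x)) e -(eqvE _ _ (rP y)).
have [k kinj kE] := universal hG chiC.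
have krE x y : (k (r x) == k (r y)) = eqv x y by rewrite (inj_eq kinj) rE.
have kchi x y : E (k (r x)) (k (r y)) = chi x y.
  have [n H] := ex [:: (x, y); (x, r x); (y, r y); (r x, r y)].
  have [/= e c] := H (x, y) (mem_head _ _).
  have [|/= e1 _] := H (x, r x); first by rewrite !inE eqxx !orbT.
  have [|/= e2 _] := H (y, r y); first by rewrite !inE eqxx !orbT.
  have [|/= e3 c3] := H (r x, r y); first by rewrite !inE eqxx !orbT.
  move: e1 e2; rewrite !rP => /eqP e1 /eqP e2.
  have [xy|xy] := eqVneq (r x) (r y).
    have /esym/eqP e' : eqv x y by rewrite -rE xy.
    by rewrite xy (E_irr hG) -c; move: e; rewrite -rE xy eqxx => /eqP ->; rewrite (E_irr hG).
  by rewrite kE // -c3 -e1 -e2.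
have hP F : exists2 n, {subset F <= S n} & same_pattern F (fs n) (k \o r).
  have [N NF] := SP F.
  have UN : U [set n | (N <= n)%N] by apply: ooU; exists N.
  have [n [/= Nn nF]] := filter_ex (filterI UN (filter_seq (s := [seq (x, y) | x <- F, y <- F])
    (A := fun p : V * V => good p.1 p.2) _ (fun p _ => Ugood p.1 p.2))).
  exists n; first exact: NF.
  move=> x y xF yF; rewrite /= krE kchi.
  exact: (nF (x, y) (allpairs_f _ xF yF)).
exists (k \o r).
  by apply: M_pat => F; have [n _ ?] := hP F; exists (fs n) => //; case: (fsP n).
move=> F; have [n Fn fnF] := hP F.
by apply: compat fnF _; apply: mono Fn _; case: (fsP n).
Qed.
End Compactness.

(** * Non-injective maps: constants, cliques and independent sets *)

(** Finitary form of having [e_E] in [M] when [e] is true, and [e_N] when [e] is false. *)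
Definition homog e := forall F : seq V, exists2 g, M g &
  forall x y, x \in F -> y \in F -> x != y -> g x != g y /\ E (g x) (g y) = e.

(* Induction on the list of values: either some value is avoided on a smaller
   type, or it occurs in all smaller types and a copy of F can be built in its fibre. *)
Lemma fiber_copy (g : V -> V) (vs S : seq V) (t : V -> bool) :
  (forall w, w \notin S -> {in S, E w =1 t} -> g w \in vs) ->
  forall F, exists i c, pemb E F i /\ {in F, forall x, g (i x) = c}.
Proof.
elim: vs S t => [|v vs IH] S t H F.
  by have [w wS /(H w wS)] := extension hG S t.
have [[S' [t' [SS' t't wv]]]|nex] := pselect (exists (S' : seq V) t',
    [/\ {subset S <= S'}, {in S, t' =1 t} &
        forall w, w \notin S' -> {in S', E w =1 t'} -> g w != v]).
  apply: (IH S' t') => w wS' wt'; have := H w; rewrite inE (negbTE (wv w wS' wt')).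
  by apply; [exact: contra (SS' w) wS'|move=> z zS; rewrite wt' ?SS' // t't].
have [|i [i1 i2]] := realize hG (s := F) (S := S) (T := fun=> t)
    (good := fun _ w => g w = v) (E_sym hG).
  move=> x S' t' _ SS' t't; apply: contrapT => nw; apply: nex; exists S', t'.
  by split=> // w wS' wt'; apply/eqP => gw; apply: nw; exists w.
exists i, v; split=> [x y xF yF|x /i1[]//].
by have [->|/(i2 _ _ xF yF)[/negbTE]] := eqVneq x y; first rewrite !eqxx !(E_irr hG).
Qed.

(** If [g] takes finitely many values on some type over a finite set, [fiber_copy] gives a constant
    copy. Otherwise every such type contains a vertex with a fresh value, and the greedy
    construction with [D] as distinctness of values under [g] gives an injective one. *)
Lemma const_or_rainbow (g : V -> V) (F : seq V) :
  exists2 i, pemb E F i & (exists c, {in F, forall x, g (i x) = c}) \/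
    (forall x y, x \in F -> y \in F -> x != y -> g (i x) != g (i y)).
Proof.
have [[S [t [vs H]]]|nex] := pselect (exists (S : seq V) t (vs : seq V),
    forall w, w \notin S -> {in S, E w =1 t} -> g w \in vs).
  by have [i [c [iF ic]]] := fiber_copy H F; exists i => //; left; exists c.
have [||||i [_ i2]] := @realize_sep _ _ hG [rel x y | g x != g y] _ F E [::]
    (fun _ _ => false) (fun _ _ => True).
- by move=> x y /=; rewrite eq_sym.
- by move=> x /=; rewrite eqxx.
- exact: E_sym.
- move=> x S' t _ _ _; apply: contrapT => nw; apply: nex; exists S', t, (map g S') => w wS wt.
  apply: contrapT => /negP gw; apply: nw; exists w; split=> // z zS /=.
  by apply: contraNneq gw => ->; exact: map_f.
exists i; last by right=> x y xF yF /(i2 _ _ xF yF)[].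
move=> x y xF yF; have [->|xy] := eqVneq x y; first by rewrite !eqxx !(E_irr hG).
have [gxy ->] := i2 _ _ xF yF xy; split=> //.
by apply/eqP => e; move: gxy; rewrite /= e eqxx.
Qed.

Lemma M_const c0 : (forall F : seq V, exists2 g, M g & exists c, {in F, forall x, g x = c}) ->
  M (fun=> c0).
Proof.
move=> H; apply: M_pat => F; have [g Mg [c gc]] := H F.
by exists g => // x y xF yF; rewrite !gc // !eqxx !(E_irr hG).
Qed.

Lemma pair_move (f : V -> V) u v x y : M f -> u != v -> x != y -> E x y = E u v ->
  exists2 a, graph_aut E a & a x = u /\ a y = v.
Proof.
move=> Mf uv xy Exy.
have yx : (y == x) = false by rewrite eq_sym (negbTE xy).
have [|a aut ai] := homogeneity hG (F := [:: x; y]) (i := fun z => if z == x then u else v).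
  move=> p q; rewrite !inE => /orP[]/eqP-> /orP[]/eqP->;
    rewrite ?eqxx ?yx ?(negbTE xy) ?(negbTE uv) ?(eq_sym v) ?(negbTE uv) ?(E_irr hG) //.
  by rewrite (E_sym hG) (E_sym hG y).
by exists a => //; rewrite !ai ?inE ?eqxx ?yx ?orbT.
Qed.

(** As long as [F] has a pair of the same kind as [(u, v)], an automorphism moves it onto [(u, v)]
    and [f] identifies it, so the number of distinct points drops. At the end only pairs of the
    other kind remain. *)
Lemma collapse_homogeneous f u v : M f -> u != v -> f u = f v ->
  forall F : seq V, exists2 g, M g &
    forall x y, x \in F -> y \in F -> g x != g y -> E (g x) (g y) = ~~ E u v.
Proof.
move=> Mf uv fuv F; have [n] := ubnP (size (undup F)); elim: n F => // n IH F sF.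
have [[x [y [xF yF xy Exy]]]|nex] := pselect (exists x y,
    [/\ x \in F, y \in F, x != y & E x y = E u v]); last first.
  exists id; first exact: M_id.
  move=> x y xF yF xy /=; have [e|] := eqVneq (E x y) (E u v);
    last by case: (E x y) (E u v) => [] [].
  by case: nex; exists x, y.
have [a aut [ax ay]] := pair_move Mf uv xy Exy.
have Mh : M (f \o a) by apply: M_comp => //; exact: M_aut.
have [|g Mg gF] := IH (map (f \o a) F).
  rewrite -ltnS; apply: leq_trans sF; rewrite ltnS.
  have xU : x \in undup F by rewrite mem_undup.
  (* The image of [F] is already the image of [F] without [x], because [x] and [y] are
     identified. *)
  apply: (@leq_ltn_trans (size (map (f \o a) (rem x (undup F))))); last first.
    by rewrite size_map size_rem // ltn_predL; case: (undup F) xU.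
  apply: uniq_leq_size (undup_uniq _) _ => z; rewrite mem_undup => /mapP[w wF ->].
  have [->|wx] := eqVneq w x.
    rewrite /= ax fuv -ay; apply: map_f; rewrite mem_rem_uniq ?undup_uniq // inE mem_undup yF.
    by rewrite eq_sym xy.
  by apply: map_f; rewrite mem_rem_uniq ?undup_uniq // inE mem_undup wF wx.
exists (g \o (f \o a)); first exact: M_comp.
by move=> p q pF qF; apply: gF; exact: map_f.
Qed.

Lemma collapse f u v : M f -> u != v -> f u = f v ->
  (exists c, M (fun=> c)) \/ homog (~~ E u v).
Proof.
move=> Mf uv fuv; have [|||g Mg gE] := @compactness (fun F g =>
  forall x y, x \in F -> y \in F -> g x != g y -> E (g x) (g y) = ~~ E u v).
- by move=> F F' g FF' gF x y xF yF; apply: gF; exact: FF'.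
- by move=> F g h gh gF x y xF yF; have [<- <-] := gh x y xF yF; exact: gF.
- exact: collapse_homogeneous Mf uv fuv.
have {}gE x y : g x != g y -> E (g x) (g y) = ~~ E u v.
  by apply: (gE [:: x; y]); rewrite !inE eqxx ?orbT.
have [H|/existsNP[F0 nF0]] := pselect (forall F : seq V,
    exists2 h, M h & exists c, {in F, forall x, h x = c}).
  by left; exists u; exact: M_const.
(* No map in [M] is constant on [F0]; adding [F0] to [F] therefore excludes the constant
   alternative. *)
right=> F; have [i iF [[c ic]|ir]] := const_or_rainbow g (F0 ++ F).
  case: nF0; have [h Mh hgi] := M_pemb Mg iF; exists h => //; exists c => x xF.
  by rewrite hgi /= ?ic ?mem_cat ?xF.
have [h Mh hgi] := M_pemb Mg iF; exists h => // x y xF yF xy.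
rewrite !hgi ?mem_cat ?xF ?yF ?orbT //=.
have gxy : g (i x) != g (i y) by apply: ir; rewrite ?mem_cat ?xF ?yF ?orbT.
by split=> //; exact: gE.
Qed.

(** * Canonical behaviour over finitely many constants *)

Section ConstantsAndThinning.
Implicit Types (C D F : seq V).

Definition autC (C : seq V) a := graph_aut E a /\ {in C, a =1 id}.

(** Encoded as a Boolean tuple so that the types over [C] can be enumerated. It is used for vertices
    outside [C]. *)
Definition tp (C : seq V) x := map_tuple (E x) (in_tuple C).

Lemma tpP C x y : tp C x = tp C y <-> {in C, E x =1 E y}.
Proof.
by split=> [/(congr1 val)/= /eq_in_map|/eq_in_map e]; last exact/val_inj.
Qed.

Lemma autC_id C : autC C id.
Proof. by split=> //; split=> //; exists id. Qed.

Lemma autC_comp C a b : autC C a -> autC C b -> autC C (a \o b).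
Proof.
move=> [[aB aE] aC] [[bB bE] bC]; split; first split.
- exact: bij_comp.
- by move=> x y; rewrite bE aE.
- by move=> x xC /=; rewrite bC // aC.
Qed.

Lemma autC_sub C D a : {subset C <= D} -> autC D a -> autC C a.
Proof. by move=> CD [aut aD]; split=> // x /CD; exact: aD. Qed.

Lemma autC_eq C a x y : autC C a -> (a x == a y) = (x == y).
Proof. by move=> [[aB _] _]; apply/inj_eq/bij_inj. Qed.

Lemma autC_E C a x y : autC C a -> E (a x) (a y) = E x y.
Proof. by move=> [[_ aE] _]; rewrite -aE. Qed.

Lemma autC_mem C a x : autC C a -> (a x \in C) = (x \in C).
Proof.
move=> aut; apply/idP/idP => [axC|xC]; last by rewrite aut.2.
suff <- : a x = x by [].
by apply/eqP; rewrite -(autC_eq _ _ aut) aut.2.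
Qed.

Lemma autC_tp C a x : autC C a -> tp C (a x) = tp C x.
Proof. by move=> aut; apply/tpP => c cC; rewrite -{1}(aut.2 c cC) (autC_E _ _ aut). Qed.

(** Homogeneity relative to [C]: glue [i] on [F] outside [C] with the identity on [C]. *)
Lemma extend_autC C F (i : V -> V) :
  (forall x, x \in F -> x \notin C -> i x \notin C /\ {in C, E (i x) =1 E x}) ->
  (forall x y, x \in F -> y \in F -> x \notin C -> y \notin C -> x != y ->
    i x != i y /\ E (i x) (i y) = E x y) ->
  exists2 a, autC C a & forall x, x \in F -> x \notin C -> a x = i x.
Proof.
move=> i1 i2; pose j x := if x \in C then x else i x.
have [|a aut aj] := homogeneity hG (F := C ++ F) (i := j).
  have mixed x y : x \in C -> y \in F -> y \notin C ->
      (x == i y) = (x == y) /\ E x (i y) = E x y.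
    move=> xC yF yC; have [iC iE] := i1 y yF yC; split.
      have -> : (x == i y) = false by apply: contraNF iC => /eqP <-.
      by apply/esym; apply: contraNF yC => /eqP <-.
    by rewrite (E_sym hG) iE // (E_sym hG).
  move=> x y; rewrite !mem_cat /j; case: ifPn => xC xF; case: ifPn => yC yF //.
  - exact: mixed.
  - by rewrite ![_ == y]eq_sym ![E _ y](E_sym hG); exact: mixed.
  have [->|xy] := eqVneq x y; first by rewrite !eqxx !(E_irr hG).
  by have [/negbTE] := i2 x y xF yF xC yC xy.
exists a; first by split=> // x xC; rewrite aj /j ?xC // mem_cat xC.
by move=> x xF xC; rewrite aj /j ?(negbTE xC) // mem_cat xF orbT.
Qed.

(** In terms of edges, [g] is a limit of restrictions of [f] to copies of finite sets over [C]. Edge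
    values of [f] on [C] itself are thereby kept. *)
Definition thin C f g := forall F : seq V, exists2 a, autC C a &
  {in F &, forall x y, E (g x) (g y) = E (f (a x)) (f (a y))}.

Lemma thin_refl C f : thin C f f.
Proof. by move=> F; exists id; first exact: autC_id. Qed.

Lemma thin_trans C f g h : thin C f g -> thin C g h -> thin C f h.
Proof.
move=> fg gh F; have [a aut aF] := gh F; have [b but bF] := fg (map a F).
by exists (b \o a) => [|x y xF yF]; [exact: autC_comp|rewrite aF // bF ?map_f].
Qed.

Lemma thin_sub C D f g : {subset C <= D} -> thin D f g -> thin C f g.
Proof. by move=> CD fg F; have [a aut aF] := fg F; exists a => //; exact: autC_sub aut. Qed.

Implicit Types (P Q : V -> V -> V -> V -> Prop).

(** [P x y x' y'] expresses that the pairs [(x, y)] and [(x', y')] are of the same kind and should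
    be treated alike. *)
Definition unif P g := forall x y x' y', P x y x' y' -> E (g x) (g y) = E (g x') (g y').

Definition unif_on C P f F := exists2 a, autC C a &
  forall x y x' y', x \in F -> y \in F -> x' \in F -> y' \in F ->
    P x y x' y' -> E (f (a x)) (f (a y)) = E (f (a x')) (f (a y')).

Definition autC_invariant C P := forall a x y x' y', autC C a -> P x y x' y' ->
  P (a x) (a y) (a x') (a y').

Definition canonizable C P := forall f, M f -> exists2 g, M g & thin C f g /\ unif P g.

Lemma thin_unif C P f g : autC_invariant C P -> thin C f g -> unif P f -> unif P g.
Proof.
move=> Pinv fg Pf x y x' y' xy; have [a aut aE] := fg [:: x; y; x'; y'].
rewrite !aE ?inE ?eqxx ?orbT //; exact/Pf/Pinv.
Qed.

Lemma thin_unif_on C P f g F : thin C f g -> unif_on C P g F -> unif_on C P f F.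
Proof.
move=> fg [a aut aP]; have [b but bE] := fg (map a F).
exists (b \o a); first exact: autC_comp.
by move=> x y x' y' xF yF x'F y'F xy /=; rewrite -!bE ?map_f //; exact: aP.
Qed.

(** Compactness reduces canonization to a finite problem: move each finite set, by an automorphism
    over [C], to a place where [f] is already uniform. *)
Lemma canonizable_unif_on C P : (forall f F, M f -> unif_on C P f F) -> canonizable C P.
Proof.
move=> H f Mf; have [|||g Mg gP] := @compactness (fun F g => exists2 a, autC C a &
  {in F &, forall x y, E (g x) (g y) = E (f (a x)) (f (a y))} /\
  forall x y x' y', x \in F -> y \in F -> x' \in F -> y' \in F ->
    P x y x' y' -> E (g x) (g y) = E (g x') (g y')).
- move=> F F' g FF' [a aut [a1 a2]]; exists a => //; split.
    by move=> x y /FF' xF /FF' yF; exact: a1.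
  by move=> x y x' y' /FF' xF /FF' yF /FF' xF' /FF' yF'; exact: a2.
- move=> F g h gh [a aut [a1 a2]]; exists a => //; split.
    by move=> x y xF yF; have [_ <-] := gh x y xF yF; exact: a1.
  move=> x y x' y' xF yF x'F y'F xy; have [_ <-] := gh x y xF yF.
  by have [_ <-] := gh x' y' x'F y'F; exact: a2.
- move=> F; have [a aut aP] := H f F Mf.
  by exists (f \o a); [apply: M_comp => //; case: aut => /M_aut|exists a].
exists g => //; split=> [F|x y x' y' xy]; first by have [a aut []] := gP F; exists a.
by have [a _ [_ ]] := gP [:: x; y; x'; y']; apply; rewrite ?inE ?eqxx ?orbT.
Qed.

Lemma canonizable_sub C P Q : (forall x y x' y', Q x y x' y' -> P x y x' y') ->
  canonizable C P -> canonizable C Q.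
Proof.
move=> QP TP f /TP[g Mg [fg Pg]]; exists g => //; split=> // x y x' y' /QP; exact: Pg.
Qed.

(** The kinds of pairs are treated one after another; by [thin_unif], later thinnings preserve the
    uniformity reached before. *)
Lemma canonizable_seq C (T : eqType) (s : seq T) (P : T -> V -> V -> V -> V -> Prop) :
  (forall t, autC_invariant C (P t)) -> (forall t, t \in s -> canonizable C (P t)) ->
  canonizable C (fun x y x' y' => exists2 t, t \in s & P t x y x' y').
Proof.
move=> Pinv; elim: s => [|t s IH] H f Mf.
  by exists f => //; split; [exact: thin_refl|move=> x y x' y' []].
have [|g Mg [fg gP]] := IH _ f Mf; first by move=> u us; apply: H; rewrite inE us orbT.
have [h Mh [gh hP]] := H t (mem_head _ _) g Mg.
exists h => //; split; first exact: thin_trans gh.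
move=> x y x' y' [u]; rewrite inE => /predU1P[->|us xy]; first exact: hP.
apply: (thin_unif _ gh gP); last by exists u.
by move=> a p q p' q' aut [v vs pq]; exists v => //; exact: Pinv.
Qed.

(* If every type refining s meets the colour false, a copy of F is built greedily
   in that colour; otherwise some refinement of s is entirely coloured true. *)
Lemma vertex_ramsey (kappa : V -> bool) C s F : exists2 a, autC C a & exists b,
  forall x, x \in F -> x \notin C -> tp C x = s -> kappa (a x) = b.
Proof.
(* The greedy copy in colour [b], possible when every finite refinement of [t] contains a vertex of
   colour [b]; vertices of types other than [s] are placed freely. *)
have step b (S : seq V) (t : V -> bool) : {subset C <= S} ->
    (forall x, tp C x = s -> {in C, E x =1 t}) ->
    (forall (S' : seq V) t', {subset S <= S'} -> {in S, t' =1 t} ->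
       exists w, [/\ w \notin S', {in S', E w =1 t'} & kappa w = b]) ->
    exists2 a, autC C a & forall x, x \in F -> x \notin C -> tp C x = s -> kappa (a x) = b.
  move=> CS st H; have [|i [i1 i2]] := realize hG (s := F) (S := S)
     (T := fun x z => if tp C x == s then t z else E x z)
     (good := fun x w => tp C x = s -> kappa w = b) (E_sym hG).
    move=> x S' t' _ SS' t't; case: eqP t't => [_|ne] t't.
      by have [w [w1 w2 w3]] := H _ _ SS' t't; exists w.
    by have [w w1 w2] := extension hG S' t'; exists w.
  have [|x y xF yF _ _|a aut ai] := @extend_autC C F i.
  - move=> x /i1[iS iT _] _; split; first by apply: contra iS; exact: CS.
    by move=> c cC; rewrite iT ?CS //; case: eqP => // /st ->.
  - exact: i2.
  by exists a => // x xF xC; rewrite ai //; case: (i1 x xF).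
have [[S [t [CS st H]]]|nex] := pselect (exists (S : seq V) (t : V -> bool),
    [/\ {subset C <= S}, forall x, tp C x = s -> {in C, E x =1 t} &
        forall w, w \notin S -> {in S, E w =1 t} -> kappa w = true]).
  have [S' t' SS' t't|a aut aP] := step true S t CS st; last by exists a => //; exists true.
  have [w w1 w2] := extension hG S' t'; exists w; split=> //; apply: H.
    by apply: contra w1; exact: SS'.
  by move=> z zS; rewrite w2 ?SS' // t't.
have [[x0 x0s]|no] := pselect (exists x, tp C x = s); last first.
  by exists id; [exact: autC_id|exists true => x _ _ xs; case: no; exists x].
have [//|x xs||a aut aP] := step false C (E x0) _ _ _; last by exists a => //; exists false.
  by apply/tpP; rewrite xs.
move=> S' t' SS' t't; apply: contrapT => nw; apply: nex; exists S', t'; split=> //.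
  by move=> x xs c cC; rewrite t't //; move: xs; rewrite -x0s => /tpP ->.
by move=> w w1 w2; apply: contrapT => /negP/negbTE kw; apply: nw; exists w.
Qed.

(** For each constant [c] and each type in turn, [vertex_ramsey] is applied to the colouring of [w]
    by [E (f c) (f w)]. *)
Lemma canonizable_constant C : canonizable C (fun x y x' y' =>
  [/\ x \in C, x' = x, y \notin C, y' \notin C & tp C y = tp C y']).
Proof.
pose P (c : V) s (x y x' y' : V) :=
  [/\ x = c, x' = c, y \notin C /\ y' \notin C, tp C y = s & tp C y' = s].
have Pinv c s : c \in C -> autC_invariant C (P c s).
  move=> cC a x y x' y' aut [-> -> [yC y'C] ys y's]; split; rewrite ?(autC_tp _ aut) //.
  - by rewrite aut.2.
  - by rewrite aut.2.
  - by rewrite !(autC_mem _ aut).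
apply: canonizable_sub (canonizable_seq (s := C)
  (P := fun c x y x' y' => c \in C /\
    exists2 s, s \in enum {: (size C).-tuple bool} & P c s x y x' y') _ _).
- move=> x y x' y' [xC -> yC y'C yy']; exists x => //; split=> //.
  exists (tp C y); first by rewrite mem_enum.
  by split.
- move=> c a x y x' y' aut [cC [s sT xy]]; split=> //; exists s => //; exact: Pinv.
move=> c cC.
apply: canonizable_sub (canonizable_seq (s := enum {: (size C).-tuple bool}) (P := P c) _ _).
- by move=> x y x' y' [_].
- by move=> s; exact: Pinv.
move=> s _; apply: canonizable_unif_on => f F Mf.
have [a aut [b ab]] := vertex_ramsey (fun w => E (f c) (f w)) s F.
exists a => // x y x' y' _ yF _ y'F [-> -> [yC y'C] ys y's].
by rewrite aut.2 // !ab.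
Qed.

(* Each l in the part s is blown up into a pool X (l, n), n < N, and one considers
   vertices w whose e-neighbours in the pools form a transversal (X (l, y l))_l. The
   box lemma makes the colours depend on l only for y in a box {a l, b l}, and the
   neighbourhoods of vertices of F are coded by choosing a l or b l. *)
Lemma canonizable_bipartite_left C (s t : (size C).-tuple bool) e : s <> t ->
  canonizable C (fun x y x' y' => [/\ x' = x, x \notin C /\ tp C x = s,
    y \notin C /\ tp C y = t, y' \notin C /\ tp C y' = t & E x y = e /\ E x y' = e]).
Proof.
move=> st; apply: canonizable_unif_on => f F Mf.
pose L := [seq x <- F | (x \notin C) && (tp C x == s)].
have LP x : (x \in L) = [&& x \notin C, tp C x == s & x \in F] by rewrite mem_filter -andbA.
have [N NP] := box L {ffun seq_sub L -> bool}.
pose Ls := [seq (l, n) | l <- L, n <- iota 0 N].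
have LsP l n : ((l, n) \in Ls) = (l \in L) && (n < N).
  apply/allpairsP/andP => [[[l' n'] /= [lL' + [-> ->]]]|[lL nN]]; first by rewrite mem_iota.
  by exists (l, n); split; rewrite //= mem_iota.
(* The vertices [X (l, n)] are twins of [l]: they have its type over [C], and edges between pools
   copy those inside [L]. *)
have [X [X1 X2]] := @realize_free _ _ hG _ Ls (fun p q => E p.1 q.1) C (fun p => E p.1)
  (fun p q => E_sym hG p.1 q.1).
have X_inj p q : p \in Ls -> q \in Ls -> (X p == X q) = (p == q).
  move=> pL qL; have [->|pq] := eqVneq p q; first exact: eqxx.
  by apply/negbTE; case: (X2 p q pL qL pq).
have XE p q : p \in Ls -> q \in Ls -> E (X p) (X q) = E p.1 q.1.
  move=> pL qL; have [->|pq] := eqVneq p q; first by rewrite !(E_irr hG).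
  by case: (X2 p q pL qL pq).
pose C' := C ++ map X Ls.
have CC' : {subset C <= C'} by move=> x xC; rewrite mem_cat xC.
(* With the pools as constants, the edge between the images of [X p] and [w] depends only on the
   type of [w] over [C']; hence [Col y] below describes all [w] with transversal [y]. *)
have [f1 Mf1 [ff1 f1P]] := @canonizable_constant C' f Mf.
apply: thin_unif_on (thin_sub CC' ff1) _.
pose ty (y : V -> nat) w := [/\ w \notin C', tp C w = t &
  {in Ls, forall p, E w (X p) = (if p.2 == y p.1 then e else ~~ e)}].
pose Col y := [ffun l : seq_sub L =>
  `[< exists w, ty y w /\ E (f1 (X (val l, y (val l)))) (f1 w) >]].
have [a [b [ab [k kP]]]] := NP Col.
have ColE y w l (lL : l \in L) : ty y w -> y l < N ->
    E (f1 (X (l, y l))) (f1 w) = Col y (SeqSub lL).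
  move=> yw ylN; rewrite ffunE /=; apply/idP/asboolP => [H|[w' [yw' H]]]; first by exists w.
  apply: etrans H; case: yw yw' => w1 w2 w3 [w1' w2' w3']; apply: f1P; split=> //.
    by rewrite mem_cat map_f ?orbT // LsP lL.
  apply/tpP => c; rewrite mem_cat => /orP[cC|/mapP[p pL ->]]; last by rewrite w3 ?w3'.
  by have /tpP -> : tp C w = tp C w' by rewrite w2 w2'.
(* Each [l] will be sent to [X (l, a l)]. Choosing [a l] or [b l] as the twin [e]-related to [r]
   makes the relation of [r] to the image of [l] equal to [E r l], and keeps [yr r] in the box. The
   value 0 off [L] is the one required by [box]. *)
pose yr r l := if l \in L then (if E r l == e then a l else b l) else 0.
pose tgt r p := if tp C r == t then (if p.2 == yr r p.1 then e else ~~ e) else E r p.1.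
have [i0 [i1 i2]] := @realize_free _ _ hG _ [seq x <- F | (x \notin C) && (x \notin L)] E C'
  (fun r z => if z \in C then E r z else has (fun p => (X p == z) && tgt r p) Ls) (E_sym hG).
have {}i1 r : r \in F -> r \notin C -> r \notin L ->
    [/\ i0 r \notin C', {in C, E (i0 r) =1 E r} & {in Ls, forall p, E (i0 r) (X p) = tgt r p}].
  move=> rF rC rL; have [|iC iT] := i1 r; first by rewrite mem_filter rC rL.
  split=> // [c cC|p pL]; first by rewrite iT ?CC' // cC.
  rewrite iT ?mem_cat ?map_f ?orbT // ifN; last by case: (X1 p pL).
  apply/hasP/idP => [[q qL]|pt]; first by rewrite X_inj // => /andP[/eqP ->].
  by exists p; rewrite ?eqxx.
have {}i2 r r' : r \in F -> r \notin C -> r \notin L -> r' \in F -> r' \notin C -> r' \notin L ->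
    r != r' -> i0 r != i0 r' /\ E (i0 r) (i0 r') = E r r'.
  by move=> rF rC rL rF' rC' rL'; apply: i2; rewrite mem_filter ?rC ?rL ?rC' ?rL'.
have aLs l : l \in L -> (l, a l) \in Ls by move=> lL; rewrite LsP lL; case: (ab l lL).
pose i x := if x \in L then X (x, a x) else i0 x.
have iE r l : l \in L -> r \in F -> r \notin C -> r \notin L ->
    i0 r != X (l, a l) /\ E (i0 r) (X (l, a l)) = E r l.
  move=> lL rF rC rL; have [iC' _ iX] := i1 r rF rC rL; split.
    by apply: contraNneq iC' => ->; rewrite mem_cat map_f ?orbT // aLs.
  rewrite iX ?aLs // /tgt /=; case: eqP => // _; rewrite /yr lL.
  have [_ _ /negbTE alb] := ab l lL; have [->|] := eqVneq (E r l) e; first by rewrite eqxx.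
  by rewrite alb; case: (E r l) (e) => [] [].
have [|x y xF yF xC yC xy|al alC ali] := @extend_autC C F i.
- move=> x xF xC; rewrite /i; case: ifPn => xL; first by case: (X1 _ (aLs x xL)).
  by have [iC' iC _] := i1 x xF xC xL; split=> //; apply: contra iC'; exact: CC'.
- rewrite /i; case: ifPn => xL; case: ifPn => yL.
  + by rewrite X_inj ?XE ?aLs // xpair_eqE (negbTE xy).
  + by rewrite eq_sym !(E_sym hG _ (i0 y)) !(E_sym hG x); exact: iE.
  + exact: iE.
  + exact: i2.
exists al => // x y _ y' xF yF _ y'F [-> [xC xs] [yC yt] [y'C y't] [xy xy']].
have xL : x \in L by rewrite LP xC xs eqxx.
suff H r : r \in F -> r \notin C -> tp C r = t -> E x r = e ->
    E (f1 (al x)) (f1 (al r)) = k (SeqSub xL) by rewrite !H.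
move=> rF rC rt xr; have rL : r \notin L by rewrite LP rt; apply/and3P => -[_ /eqP/esym].
rewrite !ali // /i xL (negbTE rL).
have yrx : yr r x = a x by rewrite /yr xL (E_sym hG) xr eqxx.
have tyr : ty (yr r) (i0 r).
  have [iC' iC iX] := i1 r rF rC rL; split=> //; first by rewrite -rt; apply/tpP.
  by move=> p /iX ->; rewrite /tgt rt eqxx.
rewrite -yrx (ColE (yr r)) //; last by rewrite yrx; case: (ab x xL).
rewrite (kP (yr r)) // => l lL; rewrite /yr ?lL ?(negbTE lL) //.
by case: ifP; [left|right].
Qed.

(** After the left-hand version, the image of a pair of given kind depends only on its left vertex;
    [vertex_ramsey] on the left part removes this dependence. *)
Lemma canonizable_bipartite C : canonizable C (fun x y x' y' =>
  [/\ [/\ x \notin C, y \notin C, x' \notin C & y' \notin C], tp C x <> tp C y,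
      tp C x = tp C x', tp C y = tp C y' & E x y = E x' y']).
Proof.
pose T := ((size C).-tuple bool * (size C).-tuple bool * bool)%type.
pose P (p : T) (x y x' y' : V) := [/\ [/\ x \notin C, y \notin C, x' \notin C & y' \notin C],
  p.1.1 <> p.1.2, tp C x = p.1.1 /\ tp C x' = p.1.1, tp C y = p.1.2 /\ tp C y' = p.1.2 &
  E x y = p.2 /\ E x' y' = p.2].
apply: canonizable_sub (canonizable_seq (s := enum {: T}) (P := P) _ _).
- move=> x y x' y' [] HC xy xx' yy' e.
  by exists (tp C x, tp C y, E x y); [rewrite mem_enum|split].
- move=> p a x y x' y' aut [[xC yC x'C y'C] pp xx' yy' e].
  by split=> //; rewrite ?(autC_tp _ aut) ?(autC_E _ _ aut) ?(autC_mem _ aut).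
move=> [[s t] e] _; have [st|st] := pselect (s = t).
  by move=> f Mf; exists f => //; split; [exact: thin_refl|move=> x y x' y' [_ []]].
apply: canonizable_unif_on => f F Mf.
have [g Mg [fg gP]] := canonizable_bipartite_left e st Mf; apply: thin_unif_on fg _.
pose nb l r := [/\ r \notin C, tp C r = t & E l r = e].
pose kappa l := `[< exists r, nb l r /\ E (g l) (g r) >].
have [a aut [b ab]] := vertex_ramsey kappa s F; exists a => //.
suff H x y : x \in F -> y \in F -> x \notin C -> tp C x = s -> nb x y -> E (g (a x)) (g (a y)) = b.
  move=> x y x' y' xF yF x'F y'F [[xC yC x'C y'C] /= _ [xs x's] [yt y't] [xy x'y']].
  by rewrite !H.
move=> xF yF xC xs [yC yt xy]; rewrite -(ab x xF xC xs).
have nbxy : nb (a x) (a y) by split; rewrite ?(autC_tp _ aut) ?(autC_E _ _ aut) ?(autC_mem _ aut).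
apply/idP/asboolP => [H|[r [[rC rt xr] H]]]; first by exists (a y).
by apply: etrans H; case: nbxy => ayC ayt axy; apply: gP;
  split; rewrite ?(autC_tp _ aut) ?(autC_mem _ aut).
Qed.

(* New constants D j cut the part into pieces labelled by their unique neighbour
   D j; pairs in different pieces are handled by the bipartite case, and Ramsey's
   theorem on labels makes the pieces look alike. *)
Lemma canonizable_part C : canonizable C (fun x y x' y' =>
  [/\ [/\ x \notin C, y \notin C, x' \notin C & y' \notin C], x != y /\ x' != y',
      tp C x = tp C y, tp C x' = tp C x /\ tp C y' = tp C y & E x y = E x' y']).
Proof.
pose P s (x y x' y' : V) := [/\ [/\ x \notin C, y \notin C, x' \notin C & y' \notin C],
  x != y /\ x' != y', tp C x = s /\ tp C y = s, tp C x' = s /\ tp C y' = s & E x y = E x' y'].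
apply: canonizable_sub (canonizable_seq (s := enum {: (size C).-tuple bool}) (P := P) _ _).
- move=> x y x' y' [] HC d xy [xx' yy'] e.
  by exists (tp C x); [rewrite mem_enum|split=> //; rewrite ?xx' ?yy' -xy].
- move=> p a x y x' y' aut [[xC yC x'C y'C] pp xx' yy' e].
  by split=> //; rewrite ?(autC_tp _ aut) ?(autC_E _ _ aut) ?(autC_mem _ aut) ?(autC_eq _ _ aut).
move=> s _; apply: canonizable_unif_on => f F Mf.
pose L := undup [seq x <- F | (x \notin C) && (tp C x == s)].
have LP x : (x \in L) = [&& x \notin C, tp C x == s & x \in F].
  by rewrite mem_undup mem_filter -andbA.
(* A colour of a pair of labels is a function: it sends the edge value of a pair of vertices to the
   edge value of its image. *)
have [N NP] := ramsey {ffun bool -> bool} (size L).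
have [D [D1 D2]] := @realize_free _ _ hG _ (iota 0 N) (fun _ _ => false) C (fun _ _ => false)
  (fun _ _ => erefl).
have D_inj j k : j < N -> k < N -> (D j == D k) = (j == k).
  move=> jN kN; have [->|jk] := eqVneq j k; first exact: eqxx.
  by apply/negbTE; case: (D2 j k _ _ jk); rewrite ?mem_iota.
pose C' := C ++ map D (iota 0 N).
have CC' : {subset C <= C'} by move=> x xC; rewrite mem_cat xC.
have DC' j : j < N -> D j \in C' by move=> jN; rewrite mem_cat map_f ?orbT // mem_iota.
have [f1 Mf1 [ff1 f1P]] := @canonizable_bipartite C' f Mf.
apply: thin_unif_on (thin_sub CC' ff1) _.
pose lab k w := [/\ w \notin C', tp C w = s & forall j, j < N -> E w (D j) = (j == k)].
pose col k l := [ffun e => `[< exists x y, [/\ lab k x, lab l y, E x y = e & E (f1 x) (f1 y)] >]].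
have lab_tp k x y : lab k x -> lab k y -> tp C' x = tp C' y.
  move=> [_ xs xD] [_ ys yD]; apply/tpP => c; rewrite mem_cat => /orP[cC|/mapP[j]].
    by have /tpP -> : tp C x = tp C y by rewrite xs ys.
  by rewrite mem_iota => jN ->; rewrite xD ?yD.
have colE k l x y : k < N -> k != l -> lab k x -> lab l y -> E (f1 x) (f1 y) = col k l (E x y).
  move=> kN kl kx ly; rewrite ffunE; apply/idP/asboolP => [H|[x' [y' [kx' ly' e H]]]].
    by exists x, y.
  apply: etrans H; apply: f1P; split;
    [|move=> /tpP/(_ (D k) (DC' k kN))| exact: lab_tp kx kx'| exact: lab_tp ly ly'|by []].
    by case: kx kx' ly ly' => ? _ _ [? _ _] [? _ _] [? _ _].
  by case: kx ly => _ _ -> // [_ _ ->] //; rewrite eqxx (negbTE kl).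
have [ks [q [sz ksN uks pw]]] := NP col.
(* The vertices of [L] receive the labels of the monochromatic list in order, one label each. *)
pose lb x := nth 0 ks (index x L).
have lbN x : x \in L -> lb x < N by move=> xL; rewrite ksN // mem_nth // sz index_mem.
have [i [i1 i2]] := @realize_free _ _ hG _ F E C'
  (fun x z => if z \in C then E x z else z == D (lb x)) (E_sym hG).
have [x xF xC|x y xF yF _ _|a aut ai] := @extend_autC C F i.
- have [iC' iT] := i1 x xF; split; first by apply: contra iC'; exact: CC'.
  by move=> c cC; rewrite iT ?CC' // cC.
- exact: i2.
exists a => //.
have labi x : x \in F -> x \notin C -> tp C x = s -> lab (lb x) (a x).
  move=> xF xC xs; have xL : x \in L by rewrite LP xC xs eqxx.
  rewrite ai //; have [iC' iT] := i1 x xF; split=> //.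
    by rewrite -xs; apply/tpP => c cC; rewrite iT ?CC' // cC.
  move=> j jN; rewrite iT ?DC' // ifN ?D_inj ?lbN //.
  by case: (D1 j) => //; rewrite mem_iota.
have H x y : x \in F -> y \in F -> x \notin C -> y \notin C -> tp C x = s -> tp C y = s ->
    index x L < index y L -> E (f1 (a x)) (f1 (a y)) = q (E x y).
  move=> xF yF xC yC xs ys xy.
  have xL : x \in L by rewrite LP xC xs eqxx.
  have yL : y \in L by rewrite LP yC ys eqxx.
  have sx : index x L < size ks by rewrite sz index_mem.
  have sy : index y L < size ks by rewrite sz index_mem.
  rewrite (@colE (lb x) (lb y)) ?lbN ?(autC_E _ _ aut) //; try exact: labi.
    by move/(pairwiseP 0): pw => /(_ _ _ sx sy xy)/eqP ->.
  by rewrite /lb nth_uniq // neq_ltn xy.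
suff H' x y : x \in F -> y \in F -> x \notin C -> y \notin C -> tp C x = s -> tp C y = s ->
    x != y -> E (f1 (a x)) (f1 (a y)) = q (E x y).
  move=> x y x' y' xF yF x'F y'F [[xC yC x'C y'C] [xy x'y'] [xs ys] [x's y's] e].
  by rewrite !H' // e.
move=> xF yF xC yC xs ys xy; case: (ltngtP (index x L) (index y L)) => ixy.
- exact: H.
- by rewrite (E_sym hG) (E_sym hG x); exact: H.
- have xL : x \in L by rewrite LP xC xs eqxx.
  have yL : y \in L by rewrite LP yC ys eqxx.
  by move: xy; rewrite -(nth_index x xL) ixy nth_index ?eqxx.
Qed.

End ConstantsAndThinning.

(** * Injective monoids that change an edge or a non-edge *)

Section Injective.
Hypothesis M_inj : forall f, M f -> injective f.
Implicit Types (F : seq V) (b : bool -> bool).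

(** This and [switches] are the finitary forms of having [-] and [sw] in [M]. *)
Definition flips := forall F, exists2 g, M g &
  forall x y, x \in F -> y \in F -> x != y -> E (g x) (g y) = ~~ E x y.

Definition switches := forall F u, exists2 g, M g &
  forall x y, x \in F -> y \in F -> x != y -> E (g x) (g y) = E x y (+) ((x == u) (+) (y == u)).

(** Pairs of [F] are corrected one at a time; a correction never spoils a pair that already has
    value [e]. *)
Lemma homog_step e :
  (forall F u v, u \in F -> v \in F -> u != v -> E u v != e -> exists2 h, M h &
     E (h u) (h v) = e /\
     forall x y, x \in F -> y \in F -> x != y -> E x y = e -> E (h x) (h y) = e) ->
  homog e.
Proof.
move=> H F; suff [g Mg gP] : exists2 g, M g & forall x y, x \in F -> y \in F -> x != y ->
    E x y = e \/ (x, y) \in [seq (x, y) | x <- F, y <- F] -> E (g x) (g y) = e.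
  exists g => // x y xF yF xy; rewrite (inj_eq (M_inj Mg)) xy gP //.
  by right; exact: allpairs_f.
elim: [seq _ | x <- F, y <- F] => [|[u v] s [g Mg gP]].
  by exists id => [|x y _ _ _ []//]; exact: M_id.
have [[uF vF uv ne]|ok] := pselect [/\ u \in F, v \in F, u != v & E (g u) (g v) != e].
  have [|||h Mh [hE hP]] := H (map g F) (g u) (g v) _ _ _ ne; rewrite ?map_f //.
    by rewrite (inj_eq (M_inj Mg)).
  exists (h \o g) => [|x y xF yF xy]; first exact: M_comp.
  rewrite inE => xyE; have [[-> ->]//|xyuv] := eqVneq (x, y) (u, v).
  rewrite /= hP ?map_f // ?(inj_eq (M_inj Mg)) // gP //.
  by case: xyE => [|/predU1P[/eqP|]]; [left|rewrite (negbTE xyuv)|right].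
exists g => // x y xF yF xy; rewrite inE => -[xye|/predU1P[[xu yv]|xys]]; try by apply: gP; auto.
apply: contrapT => /eqP gxy; apply: ok; by rewrite -xu -yv.
Qed.

(** The four Boolean functions: the constants give cliques and independent sets, negation gives
    [flips]. *)
Lemma global_cases b :
  (forall F, exists2 h, M h &
     forall x y, x \in F -> y \in F -> x != y -> E (h x) (h y) = b (E x y)) ->
  [\/ homog true, homog false, flips | forall e, b e = e].
Proof.
move=> H; case b1: (b true); case b0: (b false).
- apply: Or41 => F; have [h Mh hP] := H F; exists h => // x y xF yF xy.
  by rewrite (inj_eq (M_inj Mh)) hP //; case: (E x y).
- by apply: Or44 => -[].
- apply: Or43 => F; have [h Mh hP] := H F; exists h => // x y xF yF xy.
  by rewrite hP //; case: (E x y).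
- apply: Or42 => F; have [h Mh hP] := H F; exists h => // x y xF yF xy.
  by rewrite (inj_eq (M_inj Mh)) hP //; case: (E x y).
Qed.

(** Here [b] acts only on pairs at [u]: negation is a switch, and a constant [b] allows [homog_step]
    to correct a pair [u], [v] without harming the others. *)
Lemma star_cases b :
  (forall F u, exists2 h, M h & forall x y, x \in F -> y \in F -> x != y ->
     E (h x) (h y) = if (x == u) || (y == u) then b (E x y) else E x y) ->
  [\/ homog true, homog false, switches | forall e, b e = e].
Proof.
move=> H.
have Hh e : (forall e', b e' = e) -> homog e.
  move=> be; apply: homog_step => F u v uF vF uv _; have [h Mh hP] := H F u.
  exists h => //; split; first by rewrite hP // eqxx be.
  by move=> x y xF yF xy xye; rewrite hP // xye be; case: ifP.
case b1: (b true); case b0: (b false).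
- by apply: Or41; apply: Hh => -[].
- by apply: Or44 => -[].
- apply: Or43 => F u; have [h Mh hP] := H F u; exists h => // x y xF yF xy.
  rewrite hP //; have [xu|xu] := eqVneq x u; have [yu|yu] := eqVneq y u => /=.
  + by move: xy; rewrite xu yu eqxx.
  + by rewrite addbT; case: (E x y).
  + by rewrite addbT; case: (E x y).
  + by rewrite addbF.
- by apply: Or42; apply: Hh => -[].
Qed.

Lemma injective_cases f c d : M f -> c != d -> E (f c) (f d) != E c d ->
  [\/ homog true, homog false, flips | switches].
Proof.
move=> Mf cd fcd; apply: contrapT => no.
have nh e : ~ homog e by case: e => h; apply: no; [apply: Or41|apply: Or42].
have nf : ~ flips by move=> h; apply: no; apply: Or43.
have ns : ~ switches by move=> h; apply: no; apply: Or44.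
pose C := [:: c; d].
(* Three successive thinnings over [C]; they fix [c] and [d], so the changed edge value of this pair
   survives. *)
have [g1 Mg1 [fg1 P1]] := @canonizable_part C f Mf.
have [g2 Mg2 [fg2 P2]] := @canonizable_bipartite C g1 Mg1.
have [g Mg [fg P3]] := @canonizable_constant C g2 Mg2.
have {}P2 := thin_unif _ fg P2.
have {}P1 := thin_unif _ (thin_trans fg2 fg) P1.
have gcd : E (g c) (g d) = E (f c) (f d).
  have [a aut aE] := thin_trans fg1 (thin_trans fg2 fg) C.
  by rewrite aE ?inE ?eqxx ?orbT // !aut.2 ?inE ?eqxx ?orbT.
(* A single type over [C] contains a copy of every finite graph, so the behaviour of [g] there is
   one of the cases of [global_cases]. *)
have {fg fg1 fg2 P1} part x y : x \notin C -> y \notin C -> x != y -> tp C x = tp C y ->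
    E (g x) (g y) = E x y.
  move=> xC yC xy xtp.
  pose R p q := [/\ p \notin C, q \notin C, p != q, tp C p = tp C x & tp C q = tp C x].
  pose b e := `[< exists p q, [/\ R p q, E p q = e & E (g p) (g q)] >].
  have bE p q : R p q -> E (g p) (g q) = b (E p q).
    move=> pq; apply/idP/asboolP => [H|[p' [q' [pq' e H]]]]; first by exists p, q.
    apply: etrans H; apply: P1; last 1 first.
      by case: pq pq' => ? ? ? pt qt [? ? ? pt' qt']; split=> //; rewrite ?pt ?qt ?pt' ?qt'.
    move=> al p1 q1 p2 q2 aut [[p1C q1C p2C q2C] dd t1 t2 e'].
    by split=> //; rewrite ?(autC_tp _ aut) ?(autC_E _ _ aut) ?(autC_mem _ aut) ?(autC_eq _ _ aut).
  have [//|//|//|bid] : [\/ homog true, homog false, flips | forall e, b e = e]; last first.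
  - by rewrite bE //; split.
  - by move/nh.
  - by move/nh.
  apply: global_cases => F.
  have [i [i1 i2]] := @realize_free _ _ hG _ F E C (fun _ => E x) (E_sym hG).
  have [|h Mh hP] := @M_pemb F i g Mg.
    move=> p q pF qF; have [->|pq] := eqVneq p q; first by rewrite !eqxx !(E_irr hG).
    by have [/negbTE] := i2 p q pF qF pq.
  exists h => // p q pF qF pq; rewrite !hP //=.
  have [ipq <-] := i2 p q pF qF pq; have [ipC pt] := i1 p pF; have [iqC qt] := i1 q qF.
  by rewrite bE //; split=> //; apply/tpP.
(* Embed [F] with [u] in the type of [x] and everything else in the type of [y]: by [part], only
   pairs at [u] can change. *)
have {P2} cross x y : x \notin C -> y \notin C -> tp C x <> tp C y -> E (g x) (g y) = E x y.
  move=> xC yC xtp.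
  pose R p q := [/\ p \notin C, q \notin C, tp C p = tp C x & tp C q = tp C y].
  pose b e := `[< exists p q, [/\ R p q, E p q = e & E (g p) (g q)] >].
  have bE p q : R p q -> E (g p) (g q) = b (E p q).
    move=> pq; apply/idP/asboolP => [H|[p' [q' [pq' e H]]]]; first by exists p, q.
    apply: etrans H; apply: P2; last 1 first.
      by case: pq pq' => ? ? pt qt [? ? pt' qt']; split=> //; rewrite ?pt ?qt ?pt' ?qt'.
    move=> al p1 q1 p2 q2 aut [[p1C q1C p2C q2C] dd t1 t2 e'].
    by split=> //; rewrite ?(autC_tp _ aut) ?(autC_E _ _ aut) ?(autC_mem _ aut).
  have [//|//|//|bid] : [\/ homog true, homog false, switches | forall e, b e = e]; last first.
  - by rewrite bE //; split.
  - by move/nh.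
  - by move/nh.
  apply: star_cases => F u.
  have [i [i1 i2]] := @realize_free _ _ hG _ F E C
    (fun p => if p == u then E x else E y) (E_sym hG).
  have [|h Mh hP] := @M_pemb F i g Mg.
    move=> p q pF qF; have [->|pq] := eqVneq p q; first by rewrite !eqxx !(E_irr hG).
    by have [/negbTE] := i2 p q pF qF pq.
  exists h => // p q pF qF pq; rewrite !hP //=.
  have [ipq <-] := i2 p q pF qF pq; have [ipC pt] := i1 p pF; have [iqC qt] := i1 q qF.
  move: pt qt; have [pu|pu] := eqVneq p u; have [qu|qu] := eqVneq q u => /= /tpP pt /tpP qt.
  - by move: pq; rewrite pu qu eqxx.
  - by rewrite bE.
  - by rewrite (E_sym hG) bE // (E_sym hG).
  - by apply: part => //; rewrite pt qt.
have {part cross} outer x y : x \notin C -> y \notin C -> x != y -> E (g x) (g y) = E x y.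
  by move=> xC yC xy; have [/part|/cross] := pselect (tp C x = tp C y); auto.
(* Now [u] is sent to the constant [c'] itself, and the other points outside [C] with the type of
   [x] over the other constant; [outer] controls all pairs away from [u]. *)
have {P3} const c' x : c' \in C -> x \notin C -> E (g c') (g x) = E c' x.
  move=> c'C xC.
  pose R p := p \notin C /\ {in C, forall z, z != c' -> E p z = E x z}.
  pose b e := `[< exists p, [/\ R p, E c' p = e & E (g c') (g p)] >].
  have bE p : R p -> E (g c') (g p) = b (E c' p).
    move=> pR; apply/idP/asboolP => [H|[p' [pR' e H]]]; first by exists p.
    apply: etrans H; apply: P3; case: pR pR' => pC pz [p'C p'z]; split=> //.
    apply/tpP => z zC; have [->|zc] := eqVneq z c'; last by rewrite pz ?p'z.
    by rewrite !(E_sym hG _ c').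
  have [//|//|//|bid] : [\/ homog true, homog false, switches | forall e, b e = e]; last first.
  - by rewrite bE.
  - by move/nh.
  - by move/nh.
  apply: star_cases => F u.
  have [i0 [i1 i2]] := @realize_free _ _ hG _ F E C
    (fun p z => if z == c' then E p u else E x z) (E_sym hG).
  pose i p := if p == u then c' else i0 p.
  have iu p : p \in F -> (c' == i0 p) = false /\ E c' (i0 p) = E u p.
    move=> pF; have [ipC ipE] := i1 p pF; split.
      by apply: contraNF ipC => /eqP <-.
    by rewrite (E_sym hG) ipE // eqxx (E_sym hG).
  have [|h Mh hP] := @M_pemb F i g Mg.
    move=> p q pF qF; rewrite /i; have [->|pu] := eqVneq p u; have [->|qu] := eqVneq q u.
    - by rewrite !eqxx !(E_irr hG).
    - exact: iu.
    - by rewrite (negbTE pu) eq_sym (E_sym hG) (E_sym hG p); exact: iu.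
    have [->|pq] := eqVneq p q; first by rewrite !eqxx !(E_irr hG).
    by have [/negbTE] := i2 p q pF qF pq.
  have Ri p : p \in F -> R (i0 p).
    by move=> pF; have [ipC ipE] := i1 p pF; split=> // z zC zc; rewrite ipE // (negbTE zc).
  exists h => // p q pF qF pq; rewrite !hP //= /i.
  have [pu|pu] := eqVneq p u; have [qu|qu] := eqVneq q u => /=.
  - by move: pq; rewrite pu qu eqxx.
  - by rewrite bE ?pu; [have [_ ->] := iu q qF|exact: Ri].
  - by rewrite (E_sym hG) bE ?qu; [have [_ ->] := iu p pF; rewrite (E_sym hG)|exact: Ri].
  - by have [ipq <-] := i2 p q pF qF pq; apply: outer => //; case: (i1 p pF); case: (i1 q qF).
(* At this point [g] changes no pair except [{c, d}], so moving a wrong pair onto [(c, d)] corrects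
   it alone. *)
apply: (nh (E (g c) (g d))); apply: homog_step => F u v uF vF uv ne.
have [|a aut [au av]] := @pair_move f c d u v Mf cd uv.
  by move: ne fcd; rewrite gcd; case: (E u v); case: (E c d); case: (E _ _).
exists (g \o a); first by apply: M_comp => //; exact: M_aut.
split=> [|x y xF yF xy xye]; first by rewrite /= au av.
have autn : autC [::] a by split.
have axy : a x != a y by rewrite (autC_eq _ _ autn).
have aE : E (a x) (a y) = E (g c) (g d) by rewrite (autC_E _ _ autn).
have ncd : E (g c) (g d) != E c d by rewrite gcd.
rewrite /= -aE; have [axC|axC] := boolP (a x \in C); have [ayC|ayC] := boolP (a y \in C).
- move: axC ayC axy aE; rewrite !inE => /orP[]/eqP-> /orP[]/eqP->; rewrite ?eqxx //.
  by rewrite (E_sym hG) => _ e; rewrite e eqxx in ncd.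
- exact: const.
- by rewrite (E_sym hG) const // (E_sym hG).
- exact: outer.
Qed.

End Injective.

End LocalMonoid.

(** * Endomorphisms of structures definable in [G] *)

Section Interpretation.
Variables (V : countType) (E : rel V).

Lemma sat_aut a n (phi : formula n) : graph_iso E E a ->
  forall t, sat E phi t <-> sat E phi (map_tuple a t).
Proof.
move=> [aB aE]; have aI := bij_inj aB; have [b aK bK] := aB.
elim: phi => {n} [n|n i j|n i j|n phi IH1 psi IH2|n phi IH] t //=.
- by rewrite !tnth_map; split=> [->|/aI].
- by rewrite !tnth_map -aE; split.
- by have := IH1 t; have := IH2 t; tauto.
have cons v : [tuple of a v :: map_tuple a t] = map_tuple a [tuple of v :: t] by exact: val_inj.
split=> H v; last by apply/IH; rewrite -cons; exact: H.
by rewrite -(bK v) cons; exact: (IH _).1 (H _).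
Qed.

Variable Gamma : structure V.
Hypothesis Gamma_def : forall s : symbol Gamma, fo_definable E (@interp V Gamma s).

Lemma endomorphism_aut a : graph_aut E a -> endomorphism Gamma a.
Proof.
by move=> aut s t; have [phi phiP] := Gamma_def s; move=> /phiP /(sat_aut phi aut) /phiP.
Qed.

Lemma endomorphism_comp f g :
  endomorphism Gamma f -> endomorphism Gamma g -> endomorphism Gamma (f \o g).
Proof.
move=> fE gE s t /gE/fE; congr interp; apply: val_inj => /=; exact/esym/map_comp.
Qed.

Lemma endomorphism_local g :
  (forall F : seq V, exists2 f, endomorphism Gamma f & {in F, f =1 g}) ->
  endomorphism Gamma g.
Proof.
move=> H s t /[dup] it; have [f fE fg] := H t => /fE; congr interp; apply: val_inj => /=.
exact/eq_in_map.
Qed.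

Lemma endomorphism_automorphism f g : bijective f -> cancel f g ->
  endomorphism Gamma f -> endomorphism Gamma g -> automorphism Gamma f.
Proof.
move=> fB fK fE gE; split=> // s t; split=> [/fE//|/gE]; congr interp.
by apply: val_inj => /=; rewrite -map_comp map_id_in // => x _ /=; rewrite fK.
Qed.

End Interpretation.

(** * Local closure and the case distinction *)

Lemma graph_aut_inv (V : countType) (E : rel V) a b :
  graph_aut E a -> cancel b a -> graph_aut E b.
Proof.
move=> [aB aE] bK; split; last by move=> x y; rewrite [RHS]aE !bK.
by exists a => //; exact/(bij_can_sym aB).
Qed.

Local Open Scope classical_set_scope.

(** Approximations on the vertices with code below [n] form a sequence in [M] that is eventually
    constant at every vertex, hence converges pointwise to [f]. *)
Lemma locally_closed_limit (V : countType) (M : set (V -> V)) (f : V -> V) :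
  locally_closed_monoid M ->
  (forall F : seq V, exists2 g, M g & {in F, g =1 f}) -> M f.
Proof.
move=> [_ _ Mcl] H.
pose S n : seq V := pmap choice.unpickle (iota 0 n).
have [a aP] : exists a : nat -> V -> V, forall n, M (a n) /\ {in S n, a n =1 f}.
  have H' n : exists g, M g /\ {in S n, g =1 f} by have [g Mg gf] := H (S n); exists g.
  by have [a aP] := choice H'; exists a.
apply: (closed_cvg (F := \oo) (u_ := a : nat -> {ptws V -> discrete_topology V}) _ Mcl).
  by exists 0 => // n _; case: (aP n).
apply/(@pointwise_cvgP (discrete_topology V) (discrete_topology V)) => x A /nbhs_singleton Ax.
exists (choice.pickle x).+1 => // n /= xn; rewrite (aP n).2 //.
rewrite mem_pmap; apply/mapP; exists (choice.pickle x); last by rewrite choice.pickleK.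
by rewrite mem_iota.
Qed.

Theorem theorem7 (V : countType) (E : rel V) (hG : random_graph E)
    (eE : V -> V) (eE_inj : injective eE)
    (eE_inf : infinite_set (range eE)) (eE_clique : clique E (range eE))
    (eN : V -> V) (eN_inj : injective eN)
    (eN_inf : infinite_set (range eN)) (eN_indep : independent E (range eN))
    (neg : V -> V) (neg_iso : graph_iso E (graph_compl E) neg)
    (z : V) (sw : V -> V) (sw_iso : graph_iso E (graph_switch E z) sw)
    (Gamma : structure V)
    (Gamma_def : forall s : symbol Gamma, fo_definable E (@interp V Gamma s)) :
  (exists c : V, endomorphism Gamma (fun _ : V => c)) \/
  endomorphism Gamma eE \/
  endomorphism Gamma eN \/
  automorphism Gamma neg \/
  automorphism Gamma sw \/
  (forall f : V -> V, endomorphism Gamma f ->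
     smallest (@locally_closed_monoid V) (graph_aut E) f).
Proof.
pose M := endomorphism Gamma.
have M_aut : forall a, graph_aut E a -> M a by move=> a; exact: endomorphism_aut.
have M_comp : forall f g, M f -> M g -> M (f \o g) by exact: endomorphism_comp.
have M_local : forall g, (forall F : seq V, exists2 f, M f & {in F, f =1 g}) -> M g.
  exact: endomorphism_local.
have homogM e k : injective k -> (forall x y, x != y -> E (k x) (k y) = e) -> homog E M e -> M k.
  move=> kI kE H; apply: (M_pat hG M_aut M_comp M_local) => F; have [g Mg gP] := H F.
  exists g => // x y xF yF; have [->|xy] := eqVneq x y; first by rewrite !eqxx !(E_irr hG).
  by have [/negbTE -> ->] := gP x y xF yF xy; rewrite kE // (inj_eq kI) (negbTE xy).
have MeE : homog E M true -> M eE.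
  apply: homogM => // x y xy; apply: eE_clique; [by exists x|by exists y|].
  by move/eE_inj/eqP; rewrite (negbTE xy).
have MeN : homog E M false -> M eN.
  by apply: homogM => // x y _; apply/negbTE/eN_indep; [exists x|exists y].
have [[f [u [v [Mf uv fuv]]]]|noncollapse] :=
    pselect (exists f u v, [/\ M f, u != v & f u = f v]).
  have := collapse hG M_aut M_comp M_local Mf uv fuv.
  by case: (~~ _) => -[[c Mc]|h]; [left; exists c|right; left; exact: MeE|
    left; exists c|right; right; left; exact: MeN].
have M_inj : forall f, M f -> injective f.
  move=> f Mf x y fxy; apply/eqP/negPn/negP => xy; apply: noncollapse.
  by exists f, x, y.
have patM k : injective k -> (forall F : seq V, exists2 g, M g &
    forall x y, x \in F -> y \in F -> x != y -> E (g x) (g y) = E (k x) (k y)) -> M k.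
  move=> kI H; apply: (M_pat hG M_aut M_comp M_local) => F; have [g Mg gP] := H F.
  exists g => // x y xF yF; rewrite (inj_eq kI) (inj_eq (M_inj g Mg)).
  by have [->|xy] := eqVneq x y; [rewrite !(E_irr hG)|rewrite gP].
have [[f [c [d [Mf cd fcd]]]]|emb] :=
    pselect (exists f c d, [/\ M f, c != d & E (f c) (f d) != E c d]); last first.
  (* Every endomorphism is now an embedding, so by homogeneity it agrees with an automorphism on
     each finite set. *)
  do 5 right; move=> f Mf A [Acl autA].
  apply: locally_closed_limit => // F.
  have [|a aut aF] := homogeneity hG (F := F) (i := f); last by exists a => //; exact: autA.
  move=> x y _ _; rewrite (inj_eq (M_inj f Mf)); split=> //.
  have [->|xy] := eqVneq x y; first by rewrite !(E_irr hG).
  by apply/eqP/negPn/negP => exy; apply: emb; exists f, x, y.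
have [/MeE|/MeN|flp|swt] := injective_cases hG M_aut M_comp M_local M_inj Mf cd fcd.
- by right; left.
- by right; right; left.
- do 3 right; left.
  have [nB nE] := neg_iso; have nI := bij_inj nB; have [n' nK n'K] := nB.
  have negE x y : x != y -> E (neg x) (neg y) = ~~ E x y.
    by move=> xy; rewrite (nE x y) /graph_compl /= (inj_eq nI) xy negbK.
  have Mneg : M neg.
    by apply: patM => // F; have [g Mg gP] := flp F; exists g => // x y xF yF xy; rewrite gP ?negE.
  (* Complementing twice gives an automorphism of [G]; hence the inverse of [neg] is an automorphism
     composed with [neg], again an endomorphism. *)
  have nn : graph_aut E (neg \o neg).
    split=> [|x y /=]; first exact: bij_comp.
    by have [->|xy] := eqVneq x y; rewrite ?(E_irr hG) // !negE ?(inj_eq nI) // negbK.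
  apply: (endomorphism_automorphism (g := (n' \o n') \o neg)) => //.
    by move=> x /=; rewrite !nK.
  apply: M_comp => //; apply: M_aut; apply: graph_aut_inv nn _ => x /=.
  by rewrite !n'K.
- do 4 right; left.
  have [sB sE] := sw_iso; have sI := bij_inj sB; have [s' sK s'K] := sB.
  (* Seen from the source of [sw], the switched vertex is the preimage of [z]. *)
  pose w := s' z.
  have swE x y : E (sw x) (sw y) = E x y (+) ((x == w) (+) (y == w)).
    rewrite (sE x y) /graph_switch /= -(inj_eq sI x w) -(inj_eq sI y w) s'K.
    by case: (sw x == z); case: (sw y == z); case: (E (sw x) (sw y)).
  have Msw : M sw.
    apply: patM => // F; have [g Mg gP] := swt F w; exists g => // x y xF yF xy.
    by rewrite gP ?swE.
  (* An automorphism taking [z = sw w] back to [w] makes the second switch in [sw \o a \o sw] cancel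
     the first, so that this composite is an automorphism and the inverse of [sw] is an
     endomorphism. *)
  have [|a aut aw] := homogeneity hG (F := [:: z]) (i := fun=> w).
    by move=> x y; rewrite !inE => /eqP-> /eqP->; rewrite !eqxx !(E_irr hG).
  have [aB aE] := aut; have aI := bij_inj aB; have [a' aK a'K] := aB.
  have az : a z = w by rewrite aw ?inE.
  have sas : graph_aut E (sw \o a \o sw).
    split=> [|x y /=]; first by apply: bij_comp => //; exact: bij_comp.
    have wE t : (a (sw t) == w) = (t == w).
      by rewrite -[in LHS]az (inj_eq aI) -(inj_eq sI t w) s'K.
    by rewrite swE !wE -aE swE -addbA addbb addbF.
  apply: (endomorphism_automorphism (g := (s' \o a' \o s') \o (sw \o a))) => //.
    by move=> x /=; rewrite sK aK sK.
  apply: (M_comp); last by apply: M_comp => //; exact: M_aut.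
  by apply: M_aut; apply: graph_aut_inv sas _ => x /=; rewrite s'K a'K s'K.
Qed.
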